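(* Let $r_1,r_2,r_3\ge 0$ with at most one of them equal to zero, and let $P_1,P_2,P_3$ be independent random points with $P_k$ uniform on the circle of radius $r_k$ about $O$. Let $X$ and $Y$ be independent and uniform on $(0,\pi/2)$. Then for every $k\in\{1,2,3\}$, with $\{i,j,k\}=\{1,2,3\}$, $$p_k=\frac12\,\Pr\!\left(r_i^2\sin^2 X+r_j^2\sin^2 Y>r_k^2\right),$$ and consequently $$P(\text{obtuse})=\frac12\sum_{k=1}^{3}\Pr\!\left(r_i^2\sin^2 X+r_j^2\sin^2 Y>r_k^2\right),$$ where in each summand $i,j$ denote the two indices other than $k$.
   Context: Let $O$ be the origin of $\mathbb{R}^2$. With $\Theta_1,\Theta_2,\Theta_3$ independent and uniform on $[0,2\pi)$, set $P_k=r_k(\cos\Theta_k,\sin\Theta_k)$. For each $k$, $p_k$ is the probability that $P_1,P_2,P_3$ form a (non-degenerate) triangle whose interior angle at $P_k$ exceeds $\pi/2$; for a non-degenerate triangle this means $(P_i-P_k)\cdot(P_j-P_k)<0$. $P(\text{obtuse})$ is the probability that the triangle $P_1P_2P_3$ is obtuse, i.e. has some interior angle exceeding $\pi/2$. *)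

(* Defs.v *)
From HB Require Import structures.
From mathcomp Require Import all_boot all_order all_algebra.
From mathcomp Require Import all_classical all_reals all_analysis.

Set Implicit Arguments.
Unset Strict Implicit.
Unset Printing Implicit Defensive.

Import Order.TTheory GRing.Theory Num.Theory.

Local Open Scope classical_set_scope.
Local Open Scope ring_scope.

(* [uniform_prob] has the density (b - a)^-1 on the closed interval; this is
   the same law as on ]a, b[ or [a, b[. The two laws are compared on measurable
   sets only, because their values elsewhere carry no meaning. *)
Definition uniformly_distributed (d : measure_display) (T : measurableType d)
    (R : realType) (P : probability T R) (X : {RV P >-> R}) (a b : R) : Prop :=
  exists ab : a < b, forall A : set R, measurable A ->
    distribution P X A = uniform_prob ab A.

Definition mutually_independent (d : measure_display) (T : measurableType d)
    (R : realType) (P : probability T R) (I : finType)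
    (X : I -> {RV P >-> R}) : Prop :=
  forall (J : {set I}) (A : I -> set R), (forall i, measurable (A i)) ->
    P (\bigcap_(i in [set` J]) (X i @^-1` A i)) =
      (\prod_(i in J) P (X i @^-1` A i))%E.

Definition independent_pair (d : measure_display) (T : measurableType d)
    (R : realType) (P : probability T R) (X Y : {RV P >-> R}) : Prop :=
  forall A B : set R, measurable A -> measurable B ->
    P ((X @^-1` A) `&` (Y @^-1` B)) = (P (X @^-1` A) * P (Y @^-1` B))%E.

Definition polar_point (R : realType) (r t : R) : 'rV[R]_2 :=
  \row_(c < 2) (if c == 0 then r * cos t else r * sin t).

Definition dot (R : realType) (u v : 'rV[R]_2) : R := (u *m v^T) 0 0.

(* The library norm on row vectors is the sup norm. *)
Definition euclidean_norm (R : realType) (u : 'rV[R]_2) : R :=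
  Num.sqrt (dot u u).

(* The angle BAC; meaningful only when B and C are distinct from A. *)
Definition angle (R : realType) (B A C : 'rV[R]_2) : R :=
  acos (dot (B - A) (C - A) / (euclidean_norm (B - A) * euclidean_norm (C - A))).

(* The three points are affinely independent, i.e. not collinear. *)
Definition nondegenerate (R : realType) (p : 'I_3 -> 'rV[R]_2) : bool :=
  row_free (col_mx (p 1 - p 0) (p 2%:R - p 0)).

(* Vertex indices are added modulo 3, so k + 1 and k + 2 are the other two. *)
Definition interior_angle (R : realType) (p : 'I_3 -> 'rV[R]_2) (k : 'I_3) : R :=
  angle (p (k + 1)) (p k) (p (k + 2%:R)).

Definition obtuse_at (R : realType) (p : 'I_3 -> 'rV[R]_2) (k : 'I_3) : Prop :=
  nondegenerate p /\ pi / 2 < interior_angle p k.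

Definition obtuse (R : realType) (p : 'I_3 -> 'rV[R]_2) : Prop :=
  nondegenerate p /\ exists k : 'I_3, pi / 2 < interior_angle p k.

(* Main.v *)
Require Import Defs.
From HB Require Import structures.
From mathcomp Require Import all_boot all_order all_algebra.
From mathcomp Require Import all_classical all_reals all_analysis.
From mathcomp Require Import measurable_realfun ring lra.

Set Implicit Arguments.
Unset Strict Implicit.
Unset Printing Implicit Defensive.

Import Order.TTheory GRing.Theory Num.Theory.
Import numFieldNormedType.Exports.

Local Open Scope classical_set_scope.
Local Open Scope ring_scope.

(** The obtuse angle at a vertex: write [q], [p], [r] for the radii of [P_i],
    [P_j], [P_k], and let [U] be the uniform law on a period of length [2 pi],
    which is invariant under rotations when restricted to periodic events.

    The interior angle at [P_k] exceeds [pi / 2] exactly when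
    [(P_i - P_k) . (P_j - P_k) < 0]. For fixed [P_i] and [P_k] this is a linear
    condition on [P_j], so a rotation of the angle of [P_j] turns it into
    [p * cos c * |P_i - P_k| < (P_i - P_k) . P_k] with [c] again uniform.
    Both sides now depend on the first two angles only through their difference
    [a]; putting [P_k] at [(r, 0)] and [s = p * cos c], the event becomes
    [s * hypot (q cos a - r) (q sin a) < r * (q cos a - r)]. For [0 <= s < r]
    this says that [P_i] lies in a cone of apex [P_k] around the ray that points
    away from the origin (the set [cone q r s]).

    The law of [c] is invariant under [s -> - s], so twice the probability is
    the mean of [U (cone q r s) + U (cone q r (- s))]. This sum is computed in
    [circle_prob_cone]. If [0 <= s < r], the cone for [s] is the intersection of
    two half-planes and the cone for [- s] is their union; the sum is thus the
    sum of the measures of the two half-planes. They are exchanged by a symmetry,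
    and by rotation and reflection the sum equals
    [U (r ^ 2 < q ^ 2 * cos ^ 2 + s ^ 2)]. If [s > r], both sides equal [1].
    Integrating over [c] gives twice the probability as the probability that
    [r ^ 2 < q ^ 2 * cos ^ 2 x + p ^ 2 * cos ^ 2 c] for independent uniform [x]
    and [c], and [cos ^ 2] of a uniform angle on the circle has the law of
    [sin ^ 2] of a uniform angle on a quarter of circle.

    For the triangle: it is almost surely non-degenerate, because given two
    distinct vertices a third one of positive radius lies on their line with
    probability [0]; and
    two angles cannot both be obtuse, since
    [(P_i - P_k) . (P_j - P_k) + (P_k - P_i) . (P_j - P_i) = |P_i - P_k| ^ 2].
    Hence the probability of an obtuse triangle is the sum over the vertices. *)

(** * Lebesgue measure, periodic sets and the uniform law on the circle *)
Section lebesgue_isometries.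
Context {R : realType}.
Local Notation mu := (@lebesgue_measure R).
Implicit Types (A : set R) (t : R).

Lemma measurable_shift t : measurable_fun setT (fun x : R => x + t).
Proof. exact: measurable_funD. Qed.

Lemma lebesgue_measure_shift t A : measurable A ->
  mu ((fun x => x + t) @^-1` A) = mu A.
Proof.
move=> mA.
have mf : measurable_fun setT ((fun x => x + t) : R -> measurableTypeR R).
  exact: measurable_shift.
transitivity (pushforward mu ((fun x => x + t) : R -> measurableTypeR R) A) => //.
apply/esym/lebesgue_measure_unique => //= _ [[a b]] _ <-.
rewrite /pushforward /=.
have -> : (fun x => x + t) @^-1` `]a, b] = `]a - t, b - t]%classic :> set R.
  by apply/seteqP; split => x /=; rewrite !in_itv/= ltrBlDr lerBrDr.
by rewrite !lebesgue_measure_itv/= !lte_fin ltrD2r -!EFinD;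
  congr (if _ then _%:E else _); ring.
Qed.

Lemma lebesgue_measure_reflect t A : measurable A ->
  mu ((fun x => t - x) @^-1` A) = mu A.
Proof.
move=> mA.
rewrite -[RHS](lebesgue_measure_shift t) // -[RHS]lebesgue_measureN //; last first.
  by rewrite -[X in measurable X]setTI; apply: measurable_shift.
by rewrite /pushforward; congr (mu _); apply/seteqP; split => x /=; rewrite addrC.
Qed.

(** Endpoints are null, so intervals may be taken open or closed at will. *)
Lemma lebesgue_measure_setI_itv_bounds (b0 b1 b2 b3 : bool) (a b : R) A : measurable A ->
  mu (A `&` [set` Interval (BSide b0 a) (BSide b1 b)]) =
  mu (A `&` [set` Interval (BSide b2 a) (BSide b3 b)]).
Proof.
move=> mA.
have H : forall c0 c1, mu (A `&` [set` Interval (BSide c0 a) (BSide c1 b)]) =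
  mu (A `&` `]a, b[).
  move=> c0 c1.
  have sub : (A `&` [set` Interval (BSide c0 a) (BSide c1 b)]) `<=`
     (A `&` `]a, b[) `|` ([set a] `|` [set b]).
    move=> x [Ax] /=; rewrite in_itv /= => /andP[xa xb].
    have [->|xna] := eqVneq x a; first by right; left.
    have [->|xnb] := eqVneq x b; first by right; right.
    left; split => //=; rewrite in_itv/= lt_neqAle eq_sym xna lt_neqAle xnb /=.
    by rewrite (lteifW xa) (lteifW xb).
  apply/eqP; rewrite eq_le; apply/andP; split; last first.
    apply: le_measure; rewrite ?inE; [exact: measurableI..|].
    move=> x [Ax] /=; rewrite !in_itv/= => /andP[ax xb]; split => //.
    by rewrite !lteifS.
  have m2 : measurable ([set a] `|` [set b] : set R).
    exact: measurableU.
  apply: (@le_trans _ _ (mu ((A `&` `]a, b[) `|` ([set a] `|` [set b])))).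
    apply: le_measure; rewrite ?inE //; first exact: measurableI.
    by apply: measurableU => //; exact: measurableI.
  apply: (le_trans (measureU2 _ _ _)) => //; first exact: measurableI.
  rewrite [X in (_ + X)%E](_ : _ = 0%E) ?adde0//.
  apply: countable_lebesgue_measure0.
  by apply: finite_set_countable; rewrite finite_setU; split; exact: finite_set1.
by rewrite !H.
Qed.

End lebesgue_isometries.

Section periodic_sets.
Context {R : realType}.
Local Notation mu := (@lebesgue_measure R).
Implicit Types (A : set R) (p t : R).

(** A set of reals invariant under translation by [p]. *)
Definition periodic_set p A := forall x, A (x + p) <-> A x.

Lemma periodic_setD_int p A : periodic_set p A ->
  forall (n : int) x, A (x + n%:~R * p) <-> A x.
Proof.
move=> pA.
have pAn : forall (n : nat) x, A (x + n%:R * p) <-> A x.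
  elim=> [|n ih] x; first by rewrite mul0r addr0.
  by rewrite -natr1 mulrDl mul1r addrA; apply: (iff_trans (pA _)).
case=> n x; first exact: pAn.
have := pAn n.+1 (x + (Negz n)%:~R * p).
by rewrite NegzE mulrNz mulNr -pmulrn subrK => <-.
Qed.

Lemma lebesgue_measure_setI_itv_cat (a b c : R) A : measurable A -> a <= b <= c ->
  mu (A `&` `[a, c[) = (mu (A `&` `[a, b[) + mu (A `&` `[b, c[))%E.
Proof.
move=> mA /andP[ab bc]; rewrite -measureU; [|exact: measurableI|exact: measurableI|].
  congr (mu _); rewrite -setIUr; congr (_ `&` _); apply/seteqP; split=> x/=;
    rewrite !in_itv/=.
    by move=> /andP[ax xc]; case: (ltP x b) => xb; [left|right]; apply/andP; split.
  by case=> /andP[h1 h2]; apply/andP; split; lra.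
apply/seteqP; split=> // x [[_ /=]]; rewrite in_itv/= => /andP[_ xb] [_ /=].
by rewrite in_itv/= leNgt xb.
Qed.

(** A [p]-periodic set has the same measure in every window of length [p]. *)
Lemma lebesgue_measure_period p A t : 0 < p -> measurable A -> periodic_set p A ->
  mu (A `&` `[t, t + p[) = mu (A `&` `[0, p[).
Proof.
move=> p0 mA pA.
(* Translate by a multiple of [p] to a start [s] in the first period, then
   wrap the part beyond [p]. *)
pose n := Num.floor (t / p); pose s := t - n%:~R * p.
have mAI a b : measurable (A `&` `[a, b[ : set R) by exact: measurableI.
have s0 : 0 <= s by rewrite /s subr_ge0 -ler_pdivlMr// ge_floor.
have sp : s < p.
  have := lt_succ_floor (t / p).
  by rewrite intrD ltr_pdivrMr// mulrDl mul1r -/n /s; lra.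
transitivity (mu (A `&` `[s, s + p[)).
  rewrite -(lebesgue_measure_shift (n%:~R * p)) //; congr (mu _).
  apply/seteqP; split => x /=; rewrite !in_itv/= periodic_setD_int// => -[Ax].
    by move=> /andP[h1 h2]; split => //; rewrite /s; apply/andP; split; lra.
  by rewrite /s => /andP[h1 h2]; split => //; apply/andP; split; lra.
have sE : mu (A `&` `[s, s + p[) = (mu (A `&` `[s, p[) + mu (A `&` `[p, (s + p)%R[))%E.
  by apply: lebesgue_measure_setI_itv_cat => //; apply/andP; split; lra.
have pE : mu (A `&` `[0, p[) = (mu (A `&` `[0%R, s[) + mu (A `&` `[s, p[))%E.
  by apply: lebesgue_measure_setI_itv_cat => //; apply/andP; split; lra.
rewrite sE pE addeC; congr (_ + _)%E.
rewrite -(lebesgue_measure_shift p) //; congr (mu _).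
apply/seteqP; split => x /=; rewrite !in_itv/= => -[/pA Ax] /andP[h1 h2]; split => //;
  apply/andP; split; lra.
Qed.

End periodic_sets.

Section circle.
Context {R : realType}.
Local Notation mu := (@lebesgue_measure R).
Implicit Types (A : set R) (t : R).

Lemma uniform_probE (a b : R) (ab : a < b) A : measurable A ->
  uniform_prob ab A = (((b - a)^-1)%:E * mu (A `&` `[a, b[))%E.
Proof.
move=> mA; rewrite /uniform_prob integral_uniform_pdf.
rewrite (eq_integral (cst ((b - a)^-1)%:E)); last first.
  by move=> x /set_mem[_] /=; rewrite in_itv/= /uniform_pdf => ->.
rewrite integral_cst; last exact: measurableI.
by congr (_ * _)%E; exact: lebesgue_measure_setI_itv_bounds.
Qed.

Lemma twopi_gt0 : 0 < 2 * pi :> R.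
Proof. by rewrite mulr_gt0// pi_gt0. Qed.

(** The uniform law of an angle. It is a law on the reals rather than on a
    quotient, so its rotation invariance only concerns periodic sets. *)
Definition circle_prob : probability (measurableTypeR R) R := uniform_prob twopi_gt0.

Local Notation U := circle_prob.

Lemma circle_probE A : measurable A ->
  U A = (((2 * pi)^-1)%:E * mu (A `&` `[0%R, (2 * pi)%R[))%E.
Proof. by move=> mA; rewrite /U /= uniform_probE// subr0. Qed.

Lemma circle_prob_shift t A : measurable A -> periodic_set (2 * pi) A ->
  U ((fun x => x + t) @^-1` A) = U A.
Proof.
move=> mA pA.
have mB : measurable ((fun x : R => x + t) @^-1` A).
  by rewrite -[X in measurable X]setTI; apply: measurable_shift.
rewrite !circle_probE//; congr (_ * _)%E.
rewrite -(lebesgue_measure_period t twopi_gt0 mA pA).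
rewrite -[RHS](lebesgue_measure_shift t); last exact: measurableI.
congr (mu _); apply/seteqP; split => x /=; rewrite !in_itv/= => -[Ax] /andP[h1 h2];
  split => //;
  apply/andP; split; lra.
Qed.

(** The symmetries of a [pi]-periodic even set cut the circle into four
    equivalent quarters. *)
Lemma uniform_prob_quarter (ab : 0 < pi / 2 :> R) A : measurable A ->
    periodic_set pi A -> (forall x, A (- x) <-> A x) ->
  uniform_prob ab A = U A.
Proof.
move=> mA pA eA.
have mAI a b : measurable (A `&` `[a, b[ : set R) by exact: measurableI.
have pi0 := pi_gt0 R.
rewrite circle_probE// uniform_probE// subr0.
have E1 : mu (A `&` `[0, 2 * pi[) =
  (mu (A `&` `[0%R, pi[) + mu (A `&` `[pi, (2 * pi)%R[))%E.
  by apply: lebesgue_measure_setI_itv_cat => //; apply/andP; split; lra.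
have E2 : mu (A `&` `[0, pi[) =
  (mu (A `&` `[0%R, (pi / 2)%R[) + mu (A `&` `[(pi / 2)%R, pi[))%E.
  by apply: lebesgue_measure_setI_itv_cat => //; apply/andP; split; lra.
have E3 : mu (A `&` `[(pi / 2)%R, pi[) = mu (A `&` `[0%R, (pi / 2)%R[).
  rewrite (@lebesgue_measure_setI_itv_bounds _ _ _ false false)//.
  rewrite -(lebesgue_measure_reflect pi); last exact: measurableI.
  congr (mu _); apply/seteqP; split => x /=; rewrite !in_itv/=.
    by rewrite addrC => -[/pA /eA Ax] /andP[h1 h2]; split => //; apply/andP; split; lra.
  move=> -[Ax] /andP[h1 h2]; split; first by rewrite addrC; apply/pA/eA.
  apply/andP; split; lra.
rewrite E1 (_ : 2 * pi = pi + pi :> R) ?lebesgue_measure_period//; last by ring.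
rewrite E2 E3.
set m := mu _.
have -> : (m + m + (m + m) = 4%:E * m)%E.
  rewrite -[in LHS](mul1e m) -!ge0_muleDl ?adde_ge0 ?lee01 // -!EFinD.
  by congr (_%:E * _)%E; ring.
rewrite muleA -EFinM.
congr (_%:E * _)%E; move: (lt0r_neq0 pi0); clear; move: pi => p p0.
by field; rewrite -mulr2n mulrn_eq0 p0.
Qed.

End circle.

(** * Polar coordinates and half-plane descriptions of cones *)
Section polar_coordinates.
Context {R : rcfType}.
Implicit Types a b : R.

(** The Euclidean length of the vector with coordinates [a] and [b]. *)
Definition hypot a b : R := Num.sqrt (a ^+ 2 + b ^+ 2).

Lemma hypot_ge0 a b : 0 <= hypot a b.
Proof. exact: sqrtr_ge0. Qed.

Lemma sqr_hypot a b : hypot a b ^+ 2 = a ^+ 2 + b ^+ 2.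
Proof. by rewrite sqr_sqrtr// addr_ge0// sqr_ge0. Qed.

Lemma hypot_eq0 a b : (hypot a b == 0) = (a == 0) && (b == 0).
Proof.
by rewrite -(sqrf_eq0 (hypot a b)) sqr_hypot paddr_eq0 ?sqr_ge0// !sqrf_eq0.
Qed.

Lemma ltr_absl_sqr a b : 0 <= a -> (a < b) = (0 < b) && (a ^+ 2 < b ^+ 2).
Proof.
move=> a0; case: (ltP 0 b) => b0 /=; first by rewrite ltr_pXn2r// nnegrE// ltW.
by apply/negbTE; rewrite -leNgt (le_trans b0).
Qed.

Lemma ler_absl_sqr a b : 0 <= a -> (a <= b) = (0 <= b) && (a ^+ 2 <= b ^+ 2).
Proof.
move=> a0; case: (leP 0 b) => b0 /=; first by rewrite ler_pXn2r// nnegrE// ltW.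
by apply/negbTE; rewrite -ltNge (lt_le_trans b0).
Qed.

Lemma norm_le_hypotl a b : `|a| <= hypot a b.
Proof. by rewrite ler_absl_sqr// hypot_ge0 sqr_hypot real_normK ?num_real// lerDl
  sqr_ge0. Qed.

(** For [0 <= s < r], the vectors [(x, y)] whose angle with the first axis has
    cosine greater than [s / r] form an intersection of two half-planes. *)
Lemma lt_hypot_cone (r s w x y : R) : 0 < r -> 0 <= s -> 0 < w ->
  r ^+ 2 = s ^+ 2 + w ^+ 2 ->
  (s * hypot x y < r * x) = (0 < w * x + s * y) && (0 < w * x - s * y).
Proof.
move=> r0 s0 w0 rE.
transitivity (`|s * y| < w * x); last first.
  by rewrite ltr_norml subr_gt0 -ltrBlDl sub0r.
rewrite (ltr_absl_sqr _ (mulr_ge0 s0 (hypot_ge0 x y))) [in RHS]ltr_absl_sqr//.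
rewrite !pmulr_rgt0//; congr (_ && _).
rewrite real_normK ?num_real// exprMn sqr_hypot -subr_gt0 -[in RHS]subr_gt0;
  congr (0 < _).
by rewrite !exprMn rE; ring.
Qed.

Lemma le_hypot_cone (r s w x y : R) : 0 < r -> 0 <= s -> 0 < w ->
  r ^+ 2 = s ^+ 2 + w ^+ 2 ->
  (s * hypot x y <= r * x) = (0 <= w * x + s * y) && (0 <= w * x - s * y).
Proof.
move=> r0 s0 w0 rE.
transitivity (`|s * y| <= w * x); last first.
  by rewrite ler_norml subr_ge0 -lerBlDl sub0r.
rewrite (ler_absl_sqr _ (mulr_ge0 s0 (hypot_ge0 x y))) [in RHS]ler_absl_sqr//.
rewrite !pmulr_rge0//; congr (_ && _).
rewrite real_normK ?num_real// exprMn sqr_hypot -subr_ge0 -[in RHS]subr_ge0;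
  congr (0 <= _).
by rewrite !exprMn rE; ring.
Qed.

(** Dually, the condition for the opposite bound [- s / r] describes a union of
    the same two half-planes. *)
Lemma lt_Nhypot_cone (r s w x y : R) : 0 < r -> 0 <= s -> 0 < w ->
  r ^+ 2 = s ^+ 2 + w ^+ 2 ->
  (- s * hypot x y < r * x) = (0 < w * x + s * y) || (0 < w * x - s * y).
Proof.
move=> r0 s0 w0 rE.
rewrite ltNge -[in RHS](negbK (_ || _)) negb_or -!leNgt; congr (~~ _).
have := le_hypot_cone (- x) (- y) r0 s0 w0 rE.
rewrite /hypot !sqrrN -/(hypot x y) !mulrN -opprD oppr_ge0 opprK addrC.
rewrite -[X in _ && X]oppr_le0 opprD opprK => <-.
by rewrite mulNr lerNr.
Qed.

End polar_coordinates.

Section trigonometry.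
Context {R : realType}.

Lemma polar_decomposition (a b : R) :
  exists t, a = hypot a b * cos t /\ b = hypot a b * sin t.
Proof.
have [/eqP|h0] := eqVneq (hypot a b) 0.
  by rewrite hypot_eq0 => /andP[/eqP-> /eqP->]; exists 0;
    rewrite /hypot expr0n /= addr0 sqrtr0 !mul0r.
have hp : 0 < hypot a b by rewrite lt_neqAle eq_sym h0 hypot_ge0.
pose u := a / hypot a b; pose v := b / hypot a b.
have uv : u ^+ 2 + v ^+ 2 = 1.
  by rewrite /u /v !expr_div_n -mulrDl -sqr_hypot divff// sqrf_eq0.
have u1 : -1 <= u <= 1.
  rewrite -ler_norml -(@ler_pXn2r _ 2) ?nnegrE// expr1n real_normK ?num_real//.
  by rewrite -uv lerDl sqr_ge0.
have aE : a = hypot a b * u by rewrite mulrC divfK.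
have bE : b = hypot a b * v by rewrite mulrC divfK.
have sE : sin (acos u) = `|v|.
  by rewrite sin_acos// -uv addrAC subrr add0r sqrtr_sqr.
have uI : u \in `[(-1 : R), 1] by rewrite in_itv.
have [v0|v0] := leP 0 v.
  by exists (acos u); rewrite acosK// sE ger0_norm.
by exists (- acos u); rewrite cosN sinN acosK// sE ltr0_norm// opprK.
Qed.

Lemma measurable_cos : measurable_fun setT (@cos R).
Proof. by apply: continuous_measurable_fun; exact: continuous_cos. Qed.

Lemma measurable_sin : measurable_fun setT (@sin R).
Proof. by apply: continuous_measurable_fun; exact: continuous_sin. Qed.

Lemma cosD_twopi (x : R) : cos (x + 2 * pi) = cos x.
Proof. by rewrite mulrC mulr_natr cosD2pi. Qed.

Lemma sinD_twopi (x : R) : sin (x + 2 * pi) = sin x.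
Proof. by rewrite mulrC mulr_natr sinD2pi. Qed.

End trigonometry.

Section measurable_comparison.
Context {d} {T : measurableType d} {R : realType}.
Variables (f g : T -> R).
Hypotheses (mf : measurable_fun setT f) (mg : measurable_fun setT g).

Lemma measurable_set_lt : measurable [set x | f x < g x].
Proof.
have -> : [set x | f x < g x] = (fun x => f x < g x) @^-1` [set true].
  by apply/seteqP; split => x.
by rewrite -[X in measurable X]setTI; apply: measurable_fun_ltr.
Qed.

Lemma measurable_set_eq : measurable [set x | f x = g x].
Proof.
have -> : [set x | f x = g x] = (fun x => f x == g x) @^-1` [set true].
  by apply/seteqP; split => x /= /eqP.
by rewrite -[X in measurable X]setTI; apply: measurable_fun_eqr.
Qed.

End measurable_comparison.

(** * Rotation invariance of the uniform law *)
Section circle_probabilities.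
Context {R : realType}.
Local Notation U := (@circle_prob R).

Lemma periodic_set_trig (F : R -> R -> Prop) :
  periodic_set (2 * pi) [set x | F (cos x) (sin x)].
Proof. by move=> x /=; rewrite cosD_twopi sinD_twopi. Qed.

Lemma measurable_set_comp (f : R -> R) (B : set R) :
  measurable_fun setT f -> measurable B -> measurable [set x | B (f x)].
Proof. by move=> mf mB; rewrite -[X in measurable X]setTI; exact: mf. Qed.

(** A linear form on the circle has the law of its norm times [cos]. *)
Lemma circle_prob_rotate (a b : R) (B : set R) : measurable B ->
  U [set x | B (a * cos x + b * sin x)] = U [set x | B (hypot a b * cos x)].
Proof.
move=> mB; have [t [aE bE]] := polar_decomposition a b.
have E x : a * cos x + b * sin x = hypot a b * cos (x - t).
  by rewrite cosB; move: (hypot a b) aE bE => h -> ->; ring.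
under eq_set => x do rewrite E.
rewrite -[RHS](circle_prob_shift (- t)) //.
- by apply: measurable_set_comp => //; apply: measurable_funM => //;
  exact: measurable_cos.
- exact: (periodic_set_trig (fun c _ => B (hypot a b * c))).
Qed.

Lemma circle_prob_cosN (B : set R) : measurable B ->
  U [set x | B (- cos x)] = U [set x | B (cos x)].
Proof.
move=> mB; rewrite -[RHS](circle_prob_shift pi).
- by congr (U _); apply/seteqP; split => x /=; rewrite cosDpi.
- by apply: measurable_set_comp => //; exact: measurable_cos.
- exact: (periodic_set_trig (fun c _ => B c)).
Qed.

Lemma circle_prob_cos_eq0 (c : R) : U [set x | cos x = c] = 0%E.
Proof.
have mE : measurable [set x : R | cos x = c].
  by apply: measurable_set_eq => //; exact: measurable_cos.
rewrite circle_probE// (_ : lebesgue_measure _ = 0%E) ?mule0//.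
apply: countable_lebesgue_measure0; apply: finite_set_countable.
(* [cos] is injective on each half period, hence at most two solutions. *)
apply: (@sub_finite_set _ _ ([set acos c] `|` [set 2 * pi - acos c])); last first.
  by rewrite finite_setU; split; exact: finite_set1.
move=> x [/= <-]; rewrite in_itv/= => /andP[x0 x2].
have [xpi|xpi] := leP x pi; [left|right] => /=.
  by rewrite cosK// in_itv/= x0.
have -> : cos x = cos (2 * pi - x) 
  by rewrite -(cosN (2 * pi - x)) opprB -(cosD_twopi (x - 2 * pi)) subrK.
by rewrite cosK ?in_itv/=; [lra|apply/andP; split; lra].
Qed.

Lemma circle_prob_linear_eq0 (a b c : R) : hypot a b != 0 ->
  U [set x | a * cos x + b * sin x = c] = 0%E.
Proof.
move=> h0; rewrite (circle_prob_rotate a b (B := [set c])) //.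
rewrite -[RHS](circle_prob_cos_eq0 (c / hypot a b)); congr (U _).
apply/seteqP; split => x /=; first by move=> <-; rewrite mulrAC divff// mul1r.
by move=> ->; rewrite mulrC divfK.
Qed.

(** Inclusion-exclusion for two events, free of subtraction. *)
Lemma probabilityIU d (T : measurableType d) (P : probability T R) (A B : set T) :
  measurable A -> measurable B ->
  (P (A `&` B) + P (A `|` B) = P A + P B)%E.
Proof.
move=> mA mB; rewrite measureUfinr//; last by rewrite -ge0_fin_numE// fin_num_measure.
by rewrite addeC subeK// fin_num_measure//; exact: measurableI.
Qed.

End circle_probabilities.

(** * The two opposite cones at a vertex *)
Section cone_probability.
Context {R : realType}.
Local Notation U := (@circle_prob R).
Variables q r : R.
Hypotheses (q0 : 0 <= q) (r0 : 0 <= r) (qr0 : 0 < q + r).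

Let X (x : R) := q * cos x - r.
Let Y (x : R) := q * sin x.

(** The angles [x] for which the point of radius [q] at angle [x] is seen from
    [(r, 0)] in a direction whose cosine [k] with the first axis satisfies
    [s < r * k]. The formula multiplies out the distance, so that the apex
    itself is never in the set. *)
Definition cone (s : R) : set R := [set x | s * hypot (X x) (Y x) < r * X x].

Lemma measurable_hypot d (T : measurableType d) (f g : T -> R) :
  measurable_fun setT f -> measurable_fun setT g ->
  measurable_fun setT (fun x => hypot (f x) (g x)).
Proof.
move=> mf mg; apply: (@measurableT_comp _ _ _ _ _ _ (@Num.sqrt R)).
  by apply: continuous_measurable_fun; exact: sqrt_continuous.
by apply: measurable_funD; apply: measurable_funX.
Qed.

Let mX : measurable_fun setT X.
Proof.
by apply: measurable_funB => //; apply: measurable_funM => //; exact: measurable_cos.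
Qed.

Let mY : measurable_fun setT Y.
Proof. by apply: measurable_funM => //; exact: measurable_sin. Qed.

Lemma measurable_cone s : measurable (cone s).
Proof.
apply: measurable_set_lt; last exact: measurable_funM.
by apply: measurable_funM => //; exact: measurable_hypot.
Qed.

Lemma circle_prob_hypot_eq0 : U [set x | hypot (X x) (Y x) = 0] = 0%E.
Proof.
have mE : measurable [set x : R | hypot (X x) (Y x) = 0].
  by apply: measurable_set_eq => //; exact: measurable_hypot.
have [q00|qn0] := eqVneq q 0.
  rewrite (_ : [set _ | _] = set0) ?measure0//.
  apply/seteqP; split => // x /= /eqP; rewrite hypot_eq0 => /andP[+ _].
  by rewrite /X q00 mul0r sub0r oppr_eq0 => /eqP r00; move: qr0;
    rewrite q00 r00 addr0 ltxx.
have mc : measurable [set x : R | cos x = r / q].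
  by apply: measurable_set_eq => //; exact: measurable_cos.
apply: (@subset_measure0 _ _ _ U _ [set x | cos x = r / q]) => //; last first.
  exact: circle_prob_cos_eq0.
move=> x /= /eqP; rewrite hypot_eq0 => /andP[+ _].
by rewrite /X subr_eq0 => /eqP <-; rewrite mulrAC divff// mul1r.
Qed.

(** Beyond [r] the first cone is empty and the second one misses only the apex. *)
Lemma circle_prob_cone_outside s : r < s ->
  (U (cone s) + U (cone (- s)) = 1)%E.
Proof.
move=> rs.
have D0 x := hypot_ge0 (X x) (Y x).
have Xle x : `|r * X x| <= r * hypot (X x) (Y x).
  by rewrite normrM (ger0_norm r0) ler_wpM2l// norm_le_hypotl.
have -> : cone s = set0.
  apply/seteqP; split => // x; rewrite /cone /= ltNge => /negP; apply.
  apply: (le_trans (ler_norm _)); apply: (le_trans (Xle x)).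
  by rewrite ler_wpM2r// ltW.
have mD : measurable [set x : R | hypot (X x) (Y x) = 0].
  by apply: measurable_set_eq => //; exact: measurable_hypot.
rewrite measure0 add0e -[RHS](probability_setT U).
rewrite -(setUv (cone (- s))) measureU//; last 3 first.
- exact: measurable_cone.
- by apply: measurableC; exact: measurable_cone.
- exact: setICr.
rewrite [X in (_ + X)%E](_ : _ = 0%E) ?adde0//.
have mC : measurable (~` cone (- s)) by apply: measurableC; exact: measurable_cone.
apply: (@subset_measure0 _ _ _ U _ [set x : R | hypot (X x) (Y x) = 0]) => //; last first.
  exact: circle_prob_hypot_eq0.
move=> x; rewrite /cone /= => /negP; rewrite -leNgt mulNr => XD.
have := Xle x; rewrite ler_norml => /andP[DX _].
have : (s - r) * hypot (X x) (Y x) <= 0 by rewrite mulrBl; lra.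
rewrite pmulr_rle0 ?subr_gt0// => D1.
by apply/eqP; rewrite eq_le D1 D0.
Qed.

Lemma circle_prob_cone_inside s : 0 <= s -> s < r ->
  (U (cone s) + U (cone (- s)) = U [set x | r ^+ 2 < q ^+ 2 * cos x ^+ 2 + s ^+ 2]%R)%E.
Proof.
move=> s0 sr; have rp : 0 < r by apply: le_lt_trans sr.
pose w := Num.sqrt (r ^+ 2 - s ^+ 2).
have rs : 0 < r ^+ 2 - s ^+ 2 by rewrite subr_gt0 ltr_pXn2r// nnegrE.
have wE : w ^+ 2 = r ^+ 2 - s ^+ 2 by rewrite sqr_sqrtr// ltW.
have w0 : 0 < w by rewrite sqrtr_gt0.
have rE : r ^+ 2 = s ^+ 2 + w ^+ 2 by rewrite wE; ring.
pose A t : set R := [set x | w * r < q * w * cos x + q * t * sin x].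
have mA t : measurable (A t).
  apply: measurable_set_lt => //; apply: measurable_funD; apply: measurable_funM => //.
    exact: measurable_cos.
  exact: measurable_sin.
(* Rotating the linear form of norm [q * r] removes the dependence on the sign of [t]. *)
have UA t : t ^+ 2 = s ^+ 2 -> U (A t) = U [set x | w < q * cos x].
  move=> ts; rewrite /A (circle_prob_rotate _ _ (B := [set y | w * r < y])); last first.
    by apply: measurable_set_lt => //; exact: measurable_id.
  have -> : hypot (q * w) (q * t) = q * r.
    rewrite /hypot !exprMn ts -mulrDr [_ + s ^+ 2]addrC -rE -exprMn sqrtr_sqr.
    by rewrite ger0_norm// mulr_ge0.
  congr (U _); apply/seteqP; split => x /=; rewrite mulrAC ltr_pM2r//.
have -> : cone s = A s `&` A (- s).
  apply/seteqP; split => x; rewrite /cone /A /= (lt_hypot_cone _ _ rp s0 w0 rE) /X /Y.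
    by move=> /andP[h1 h2]; split; lra.
  by move=> [h1 h2]; apply/andP; split; lra.
have -> : cone (- s) = A s `|` A (- s).
  apply/seteqP; split => x; rewrite /cone /A /= (lt_Nhypot_cone _ _ rp s0 w0 rE) /X /Y.
    by move=> /orP[h|h]; [left|right]; lra.
  by move=> [h|h]; apply/orP; [left|right]; lra.
rewrite (probabilityIU U (mA s) (mA (- s))) !UA ?sqrrN//.
have mB : measurable [set y | w < q * y].
  by apply: measurable_set_lt => //; apply: measurable_funM => //; exact: measurable_id.
have mc (B : set R) : measurable B -> measurable [set x : R | B (cos x)].
  by move=> mB'; apply: measurable_set_comp => //; exact: measurable_cos.
(* One of the two equal terms is reflected to [- q * cos x], making them disjoint. *)
rewrite -{2}(circle_prob_cosN mB) /= -measureU//; last 3 first.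
- exact: (mc _ mB).
- apply: measurable_set_lt => //; apply: measurable_funM => //.
  by apply: measurableT_comp => //; exact: measurable_cos.
- by apply/seteqP; split => // x [/= h1]; rewrite mulrN => h2; lra.
congr (U _); apply/seteqP; split => x /=.
  move=> h; have {}h : w < `|q * cos x|.
    by case: h; rewrite ?mulrN => h; apply: (lt_le_trans h);
      rewrite ?ler_norm// -normrN ler_norm.
  have : w ^+ 2 < (q * cos x) ^+ 2.
    by rewrite -(real_normK (num_real (q * cos x))) ltr_pXn2r// nnegrE ltW.
  by rewrite wE exprMn; lra.
move=> h; have : w ^+ 2 < `|q * cos x| ^+ 2.
  by rewrite real_normK ?num_real// wE exprMn; lra.
rewrite ltr_pXn2r ?nnegrE ?normr_ge0 ?(ltW w0)//.
by rewrite lter_normr mulrN; case/orP; [left|right].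
Qed.

(** The key computation. The value [|s| = r] has to be excluded: with [r = 0]
    the left-hand side vanishes there while the right-hand side is [1] as soon
    as [q > 0]. *)
Lemma circle_prob_cone s : s ^+ 2 != r ^+ 2 ->
  (U (cone s) + U (cone (- s)) = U [set x | r ^+ 2 < q ^+ 2 * cos x ^+ 2 + s ^+ 2]%R)%E.
Proof.
wlog s0 : s / 0 <= s => [hwlog|].
  have [|/ltW s0] := leP 0 s; first exact: hwlog.
  rewrite -[in X in X -> _](sqrrN s) => /hwlog; rewrite oppr_ge0 => /(_ s0).
  by rewrite opprK sqrrN addeC.
move=> sr; have [{}sr|rs] := ltP s r; first exact: circle_prob_cone_inside.
have {rs}sr : r < s by rewrite lt_neqAle rs andbT; apply: contraNneq sr => ->.
rewrite circle_prob_cone_outside// (_ : [set _ | _] = setT) ?probability_setT//.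
apply/seteqP; split => // x _ /=.
have : r ^+ 2 < s ^+ 2 by rewrite ltr_pXn2r// nnegrE.
have : 0 <= q ^+ 2 * cos x ^+ 2 by rewrite mulr_ge0// sqr_ge0.
lra.
Qed.

End cone_probability.

(** * The averaged probability of an obtuse angle at a vertex *)
Section product_sections.
Context d1 d2 (T1 : measurableType d1) (T2 : measurableType d2) (R : realType).
Variables (P1 : probability T1 R) (P2 : probability T2 R).
Implicit Type S : set (T1 * T2).
Local Open Scope ereal_scope.

(** The next three lemmas are Fubini's theorem for indicator functions, with the
    sections written as comprehensions. *)
Lemma product_measure_sections S :
  (P1 \x P2) S = \int[P1]_x P2 [set y | S (x, y)].
Proof.
by apply: eq_integral => x _ /=; congr (P2 _); exact: xsectionE.
Qed.

Lemma product_measure_sectionsC S : measurable S ->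
  (P1 \x P2) S = \int[P2]_y P1 [set x | S (x, y)].
Proof.
move=> mS; transitivity ((P1 \x^ P2) S).
  by apply: product_measure_unique => //= ? ? ? ?; rewrite product_measure2E.
by apply: eq_integral => y _ /=; congr (P1 _); exact: ysectionE.
Qed.

Lemma integral_probability_swap S : measurable S ->
  \int[P1]_x P2 [set y | S (x, y)] = \int[P2]_y P1 [set x | S (x, y)].
Proof. by move=> mS; rewrite -product_measure_sections product_measure_sectionsC. Qed.

Lemma measurable_section_prob S : measurable S ->
  measurable_fun setT (fun x => P2 [set y | S (x, y)]).
Proof.
move=> mS; have := measurable_fun_xsection P2 mS; apply: eq_measurable_fun => x _ /=.
by rewrite xsectionE.
Qed.

End product_sections.

Section obtuse_torus.
Context {R : realType}.
Local Notation U := (@circle_prob R).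
Variables q p r : R.
Hypotheses (q0 : 0 <= q) (p0 : 0 <= p) (r0 : 0 <= r) (qr0 : 0 < q + r) (pr0 : 0 < p + r).

(** The dot product [(P_i - P_k) . (P_j - P_k)] when [P_i], [P_j], [P_k] have
    radii [q], [p], [r] and angles [ti], [tj], [tk]. *)
Definition planar_dot (ti tj tk : R) : R :=
  (q * cos ti - r * cos tk) * (p * cos tj - r * cos tk) +
  (q * sin ti - r * sin tk) * (p * sin tj - r * sin tk).

(** The event is linear in the point at angle [tj]; once rotated, it depends on
    the other two angles only through [ti - tk]. *)
Lemma circle_prob_planar_dot ti tk :
  U [set tj | planar_dot ti tj tk < 0] = U [set c | cone q r (p * cos c) (ti - tk)].
Proof.
pose a := q * cos ti - r * cos tk; pose b := q * sin ti - r * sin tk.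
have one t : cos t ^+ 2 + sin t ^+ 2 = 1 :> R by exact: cos2Dsin2.
have hab : hypot a b = hypot (q * cos (ti - tk) - r) (q * sin (ti - tk)).
  congr (Num.sqrt _); rewrite cosB sinB /a /b.
  have := one ti; have := one tk.
  move: (cos ti) (sin ti) (cos tk) (sin tk) => c1 s1 c2 s2 E2 E1.
  transitivity (q ^+ 2 * (c1 ^+ 2 + s1 ^+ 2) + r ^+ 2 * (c2 ^+ 2 + s2 ^+ 2)
    - 2 * q * r * (c1 * c2 + s1 * s2)).
    by ring.
  rewrite E1 E2.
  transitivity (q ^+ 2 * ((c1 ^+ 2 + s1 ^+ 2) * (c2 ^+ 2 + s2 ^+ 2)) + r ^+ 2
    - 2 * q * r * (c1 * c2 + s1 * s2)).
    by rewrite E1 E2; ring.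
  by ring.
have dE : a * (r * cos tk) + b * (r * sin tk) = r * (q * cos (ti - tk) - r).
  rewrite cosB /a /b; have := one tk.
  move: (cos ti) (sin ti) (cos tk) (sin tk) => c1 s1 c2 s2 E2.
  transitivity (r * (q * (c1 * c2 + s1 * s2) - r * (c2 ^+ 2 + s2 ^+ 2))); first by ring.
  by rewrite E2 mulr1.
pose B : set R := [set y | y < r * (q * cos (ti - tk) - r)].
have mB : measurable B by apply: measurable_set_lt => //; exact: measurable_id.
transitivity (U [set tj | B (p * a * cos tj + p * b * sin tj)]).
  congr (U _); apply/seteqP; split => tj; rewrite /B /= -dE /planar_dot -/a -/b; lra.
rewrite (circle_prob_rotate _ _ mB) /B; congr (U _).
have -> : hypot (p * a) (p * b) = p * hypot a b.
  by rewrite /hypot !exprMn -mulrDr sqrtrM ?sqr_ge0// sqrtr_sqr ger0_norm.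
by rewrite hab; apply/seteqP; split => c; rewrite /cone /= mulrAC.
Qed.

Lemma measurable_cone2 d (T : measurableType d) (f g : T -> R) :
  measurable_fun setT f -> measurable_fun setT g ->
  measurable [set w | cone q r (f w) (g w)].
Proof.
move=> mf mg; have mX : measurable_fun setT (fun w => q * cos (g w) - r).
  apply: measurable_funB => //; apply: measurable_funM => //.
  by apply: measurableT_comp => //; exact: measurable_cos.
apply: measurable_set_lt; last exact: measurable_funM.
apply: measurable_funM => //; apply: measurable_hypot => //; apply: measurable_funM => //.
by apply: measurableT_comp => //; exact: measurable_sin.
Qed.

Lemma periodic_set_cone s : periodic_set (2 * pi) (cone q r s).
Proof.
pose F x y : Prop := s * hypot (q * x - r) (q * y) < r * (q * x - r).
exact: (periodic_set_trig F).
Qed.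

Local Open Scope ereal_scope.

(** After exchanging the integrals, the shift by [tk] is absorbed by rotation
    invariance. *)
Lemma integral_planar_dot tk :
  \int[U]_ti U [set tj | planar_dot ti tj tk < 0]%R =
  \int[U]_c U (cone q r (p * cos c)).
Proof.
under eq_integral do rewrite circle_prob_planar_dot.
pose S : set (R * R) := [set z | cone q r (p * cos z.2) (z.1 - tk)%R].
have mS : measurable S.
  apply: measurable_cone2.
    by apply: measurable_funM => //; apply: measurableT_comp => //; exact: measurable_cos.
  by apply: measurable_funB.
rewrite (@integral_probability_swap _ _ _ _ _ U U S mS).
apply: eq_integral => c _; rewrite -[RHS](circle_prob_shift (- tk)) //.
  exact: measurable_cone.
exact: periodic_set_cone.
Qed.

(** The half-turn [c -> c + pi] changes the sign of [cos c]. *)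
Lemma integral_cone_cosN :
  \int[U]_c U (cone q r (p * cos c)) = \int[U]_c U (cone q r (- (p * cos c))).
Proof.
pose S (e : R) : set (R * R) := [set z | cone q r (e * p * cos z.1) z.2]%R.
have mS e : measurable (S e).
  apply: measurable_cone2 => //.
  by apply: measurable_funM => //; apply: measurableT_comp => //; exact: measurable_cos.
transitivity (\int[U]_a U [set c | S 1%R (c, a)]).
  rewrite -(@integral_probability_swap _ _ _ _ _ U U _ (mS 1%R)).
  by apply: eq_integral => c _; congr (U _); rewrite /S /= mul1r.
transitivity (\int[U]_a U [set c | S (-1)%R (c, a)]); last first.
  rewrite -(@integral_probability_swap _ _ _ _ _ U U _ (mS (-1)%R)).
  by apply: eq_integral => c _; congr (U _); rewrite /S /= !mulNr mul1r.
apply: eq_integral => a _.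
rewrite -(@circle_prob_cosN _ [set y | cone q r (1 * p * y)%R a]).
  by congr (U _); rewrite /S; apply/seteqP; split => c /=; rewrite mulrN !mulNr.
exact: measurable_cone2.
Qed.

(** The values excluded in [circle_prob_cone] are negligible. *)
Lemma circle_prob_pcos_eq : U [set c | (p * cos c) ^+ 2 = r ^+ 2]%R = 0.
Proof.
have mE : measurable [set c : R | (p * cos c) ^+ 2 = r ^+ 2]%R.
  apply: measurable_set_eq => //; apply: measurable_funX; apply: measurable_funM => //.
  exact: measurable_cos.
have [p00|pn0] := eqVneq p 0%R.
  rewrite (_ : [set _ | _] = set0) ?measure0//.
  apply/seteqP; split => // c /= /eqP;
    rewrite p00 mul0r expr0n /= eq_sym sqrf_eq0 => /eqP r00.
  by move: pr0; rewrite p00 r00 addr0 ltxx.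
have mc (e : R) : measurable [set c : R | cos c = e].
  by apply: measurable_set_eq => //; exact: measurable_cos.
apply: (@subset_measure0 _ _ _ U _ ([set c | cos c = r / p] `|` [set c | cos c =
  - (r / p)])%R) => //.
- by apply: measurableU; exact: mc.
- move=> c /= /eqP; rewrite eqf_sqr => /orP[] /eqP E; [left|right] => /=.
    by rewrite -E mulrAC divff// mul1r.
  by rewrite -mulNr -E mulrAC divff// mul1r.
- transitivity (U [set c | cos c = r / p]%R); last exact: circle_prob_cos_eq0.
  by apply: measureU0; [exact: mc|exact: mc|exact: circle_prob_cos_eq0].
Qed.

Lemma integral_cone_sum :
  \int[U]_c U (cone q r (p * cos c)) + \int[U]_c U (cone q r (p * cos c)) =
  \int[U]_c U [set x | r ^+ 2 < q ^+ 2 * cos x ^+ 2 + p ^+ 2 * cos c ^+ 2]%R.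
Proof.
rewrite {2}integral_cone_cosN.
pose S (e : R) : set (R * R) := [set z | cone q r (e * p * cos z.1) z.2]%R.
have mS e : measurable (S e).
  apply: measurable_cone2 => //.
  by apply: measurable_funM => //; apply: measurableT_comp => //; exact: measurable_cos.
have m1 : measurable_fun setT (fun c => U (cone q r (p * cos c)%R)).
  have := measurable_section_prob U (mS 1%R); apply: eq_measurable_fun => c _.
  by congr (U _); rewrite /S /= mul1r.
have m2 : measurable_fun setT (fun c => U (cone q r (- (p * cos c))%R)).
  have := measurable_section_prob U (mS (-1)%R); apply: eq_measurable_fun => c _.
  by congr (U _); rewrite /S /= !mulNr mul1r.
rewrite -ge0_integralD//.
pose G : set (R * R) := [set z | r ^+ 2 <
  q ^+ 2 * cos z.2 ^+ 2 + p ^+ 2 * cos z.1 ^+ 2]%R.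
have mG : measurable G.
  apply: measurable_set_lt => //; apply: measurable_funD; apply: measurable_funM => //;
    apply: measurable_funX; apply: measurableT_comp => //; exact: measurable_cos.
apply: ge0_ae_eq_integral => //.
- exact: emeasurable_funD.
- exact: (measurable_section_prob U mG).
- by move=> c _; exact: adde_ge0.
exists [set c | (p * cos c) ^+ 2 = r ^+ 2]%R; split.
- apply: measurable_set_eq => //; apply: measurable_funX; apply: measurable_funM => //.
  exact: measurable_cos.
- exact: circle_prob_pcos_eq.
- move=> c /= nE; apply/eqP; apply: contrapT => /negP h; apply: nE => _.
  by rewrite circle_prob_cone// exprMn.
Qed.

End obtuse_torus.

(** * Events on three independent angles *)
Section planar_events.
Context {R : realType}.
Local Notation U := (@circle_prob R).

Lemma triple_product_sections (m1 m2 m3 : probability (measurableTypeR R) R)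
    (S : set (R * (R * R))) :
  (m1 \x (m2 \x m3))%E S = (\int[m1]_x \int[m2]_y m3 [set z | S (x, (y, z))])%E.
Proof.
pose m23 : probability (measurableTypeR R * measurableTypeR R)%type R := (m2 \x m3)%E.
rewrite -[LHS]/((m1 \x m23)%E S) product_measure_sections.
by apply: eq_integral => x _; rewrite -[LHS]/((m2 \x m3)%E _) product_measure_sections.
Qed.

Let mcos d (T : measurableType d) (f : T -> R) :
  measurable_fun setT f -> measurable_fun setT (fun x => cos (f x)).
Proof. by move=> mf; apply: measurableT_comp => //; exact: measurable_cos. Qed.

Let msin d (T : measurableType d) (f : T -> R) :
  measurable_fun setT f -> measurable_fun setT (fun x => sin (f x)).
Proof. by move=> mf; apply: measurableT_comp => //; exact: measurable_sin. Qed.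

Let mlin d (T : measurableType d) (a b : R) (f g : T -> R) :
  measurable_fun setT f -> measurable_fun setT g ->
  measurable_fun setT (fun x => a * f x - b * g x).
Proof. by move=> mf mg; apply: measurable_funB; apply: measurable_funM. Qed.

Let m1 : measurable_fun setT (fun z : R * (R * R) => z.1).
Proof. exact: measurable_fst. Qed.

Let m21 : measurable_fun setT (fun z : R * (R * R) => z.2.1).
Proof. by apply: (@measurableT_comp _ _ _ _ _ _ fst) => //; exact: measurable_snd. Qed.

Let m22 : measurable_fun setT (fun z : R * (R * R) => z.2.2).
Proof. by apply: (@measurableT_comp _ _ _ _ _ _ snd) => //; exact: measurable_snd. Qed.

Lemma measurable_planar_dot (q p r : R) :
  measurable [set z : R * (R * R) | planar_dot q p r z.2.1 z.2.2 z.1 < 0].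
Proof.
apply: measurable_set_lt => //.
by apply: measurable_funD; apply: measurable_funM; apply: mlin;
  (apply: mcos || apply: msin).
Qed.

(** Twice the mean of the cone probability is the integral on the right. *)
Lemma circle_prob_planar_dot_lt0 (q p r : R) :
  0 <= q -> 0 <= p -> 0 <= r -> 0 < q + r -> 0 < p + r ->
  (U \x (U \x U))%E [set z | planar_dot q p r z.2.1 z.2.2 z.1 < 0] =
  ((2^-1)%:E * \int[U]_c
    U [set x | (r ^+ 2 < q ^+ 2 * cos x ^+ 2 + p ^+ 2 * cos c ^+ 2)%R])%E.
Proof.
move=> q0 p0 r0 qr0 pr0; rewrite triple_product_sections /=.
rewrite -integral_cone_sum//.
set I := (\int[U]_c U (cone q r (p * cos c)))%E.
have I0 : (0 <= I)%E by apply: integral_ge0.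
transitivity (\int[U]_tk (cst I tk))%E.
  by apply: eq_integral => tk _; rewrite integral_planar_dot.
transitivity (I * U setT)%E; first by apply: integral_cst.
rewrite (_ : U setT = 1%E) ?mule1; last exact: probability_setT.
rewrite ge0_muleDr// -ge0_muleDl ?lee_fin ?invr_ge0// -EFinD.
by rewrite (_ : 2^-1 + 2^-1 = 1 :> R) ?mul1e//; field.
Qed.

(** The determinant of [P_i - P_k] and [P_j - P_k], in the notation of
    [planar_dot]; it vanishes exactly when the three points are collinear. *)
Definition planar_cross (q p r : R) (ti tj tk : R) : R :=
  (q * cos ti - r * cos tk) * (p * sin tj - r * sin tk) -
  (q * sin ti - r * sin tk) * (p * cos tj - r * cos tk).

Lemma measurable_planar_cross (q p r : R) :
  measurable [set z : R * (R * R) | planar_cross q p r z.2.1 z.2.2 z.1 = 0].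
Proof.
apply: measurable_set_eq => //.
by apply: measurable_funB; apply: measurable_funM; apply: mlin;
  (apply: mcos || apply: msin).
Qed.

(** If the points at [ti] and [tk] differ, the condition on [tj] is a non-trivial
    linear equation; they coincide for a negligible set of [ti]. *)
Lemma circle_prob_planar_cross0 (q p r : R) : 0 < q -> 0 < p ->
  (U \x (U \x U))%E [set z | planar_cross q p r z.2.1 z.2.2 z.1 = 0] = 0%E.
Proof.
move=> q0 p0; rewrite triple_product_sections /=.
apply: integral0_eq => tk _.
have mS : measurable [set z : R * R | planar_cross q p r z.1 z.2 tk = 0].
  rewrite -[X in measurable X](xsectionE
    [set z : R * (R * R) | planar_cross q p r z.2.1 z.2.2 z.1 = 0] tk).
  by apply: measurable_xsection; exact: measurable_planar_cross.
transitivity (\int[U]_ti (cst 0%E : R -> \bar R) ti)%E; last by rewrite integral0.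
apply: ge0_ae_eq_integral => //.
- exact: (measurable_section_prob U mS).
(* Coincidence of the points at [ti] and [tk] forces equal abscissas. *)
exists [set ti | q * cos ti + 0 * sin ti = r * cos tk]; split.
- apply: measurable_set_eq => //.
  by apply: measurable_funD => //; apply: measurable_funM => //;
    [apply: mcos|apply: msin].
- apply: circle_prob_linear_eq0.
  by rewrite hypot_eq0 negb_and gt_eqF.
- move=> ti /= nE; apply: contrapT; rewrite mul0r addr0 => h; apply: nE => _.
  pose a := q * cos ti - r * cos tk; pose b := q * sin ti - r * sin tk.
  have a0 : a != 0 by rewrite subr_eq0; apply/eqP.
  rewrite -[RHS](@circle_prob_linear_eq0 _ (- (b * p)) (a * p)
    (a * (r * sin tk) - b * (r * cos tk))).
    by congr (U _); apply/seteqP; split => tj /=; rewrite /planar_cross -/a -/b => h';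
      lra.
  by rewrite hypot_eq0 negb_and mulf_neq0 ?orbT// gt_eqF.
Qed.

End planar_events.

(** * Joint laws of independent random variables *)
Section joint_laws.
Context {R : realType} d (T : measurableType d) (P : probability T R).
Local Open Scope ereal_scope.

Lemma measurable_RV_preimage (X : {RV P >-> R}) (A : set R) : measurable A ->
  measurable (X @^-1` A).
Proof. by move=> mA; rewrite -[X in measurable X]setTI; exact: (measurable_funPT X). Qed.

(** Independence determines the joint law: it is the product of the marginals. *)
Lemma pair_law (X Y : {RV P >-> R}) (mu nu : probability (measurableTypeR R) R) :
  (forall A, measurable A -> P (X @^-1` A) = mu A) ->
  (forall A, measurable A -> P (Y @^-1` A) = nu A) ->
  independent_pair X Y ->
  forall S : set (R * R), measurable S -> P [set w | S (X w, Y w)] = (mu \x nu) S.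
Proof.
move=> EX EY XY S mS.
have mXY : measurable_fun setT
    ((fun w => (X w, Y w)) : T -> (measurableTypeR R * measurableTypeR R)%type).
  by apply: measurable_fun_pair;
    [exact: (measurable_funPT X)|exact: (measurable_funPT Y)].
transitivity (pushforward P
  ((fun w => (X w, Y w)) : T -> (measurableTypeR R * measurableTypeR R)%type) S) => //.
apply/esym/product_measure_unique => // A B mA mB /=.
by rewrite /pushforward -EX// -EY// -XY.
Qed.

Lemma triple_law (X1 X2 X3 : {RV P >-> R})
    (m1 m2 m3 : probability (measurableTypeR R) R) :
  (forall A B C, measurable A -> measurable B -> measurable C ->
    P (X1 @^-1` A `&` (X2 @^-1` B `&` X3 @^-1` C)) = m1 A * (m2 B * m3 C)) ->
  forall S : set (R * (R * R)), measurable S ->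
    P [set w | S (X1 w, (X2 w, X3 w))] = (m1 \x (m2 \x m3)) S.
Proof.
move=> E S mS.
pose f : T -> (measurableTypeR R * measurableTypeR R)%type := fun w => (X2 w, X3 w).
pose g : T -> (measurableTypeR R * (measurableTypeR R * measurableTypeR R))%type :=
  fun w => (X1 w, (X2 w, X3 w)).
have mf : measurable_fun setT f by apply: measurable_fun_pair;
  [exact: (measurable_funPT X2)|exact: (measurable_funPT X3)].
have mg : measurable_fun setT g.
  by apply: measurable_fun_pair; [exact: (measurable_funPT X1)|exact: mf].
transitivity (pushforward P g S) => //.
(* The product is repackaged as a probability, hence as a sigma-finite measure. *)
pose m23 : probability (measurableTypeR R * measurableTypeR R)%type R := m2 \x m3.
apply/esym/(product_measure_unique (m2 := m23)) => // A C mA mC /=.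
have mXA := measurable_RV_preimage X1 mA.
(* For fixed [A], both sides are finite measures in [C] that agree on rectangles. *)
transitivity (pushforward (mrestr P mXA) f C).
  by rewrite /pushforward /mrestr /g; congr (P _); apply/seteqP; split => w /= [].
have mA0 : (0 <= fine (m1 A))%R by rewrite fine_ge0.
transitivity ((mscale (NngNum mA0) m2 \x m3) C).
  apply/esym/product_measure_unique => // B D mB mD /=.
  rewrite /pushforward /mrestr /f /mscale /=.
  rewrite fineK ?fin_num_measure// -muleA -E//.
  by congr (P _); apply/seteqP; split => w /= [] => [[]|? []].
rewrite /product_measure1 ge0_integral_mscale//.
  by rewrite /= fineK ?fin_num_measure.
exact: measurable_fun_xsection.
Qed.

End joint_laws.

Section sine_law.
Context {R : realType}.
Local Notation U := (@circle_prob R).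

(** The law of [sin ^ 2] on a quarter of circle is that of [cos ^ 2] on the circle. *)
Lemma uniform_prob_sin2 (ab : 0 < pi / 2 :> R) (B : set R) : measurable B ->
  uniform_prob ab [set x | B (sin x ^+ 2)] = U [set x | B (cos x ^+ 2)].
Proof.
move=> mB; have mS : measurable [set x : R | B (sin x ^+ 2)].
  apply: (@measurable_set_comp _ (fun x => sin x ^+ 2)) => //.
  by apply: measurable_funX; exact: measurable_sin.
rewrite uniform_prob_quarter//; last 2 first.
- by move=> x /=; rewrite sinDpi sqrrN.
- by move=> x /=; rewrite sinN sqrrN.
rewrite -(circle_prob_shift (pi / 2) mS); last first.
  exact: (periodic_set_trig (fun _ y => B (y ^+ 2))).
by congr (U _); apply/seteqP; split => x /=; rewrite sinDpihalf.
Qed.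

(** The same replacement for a pair, one coordinate at a time. *)
Lemma integral_sin2_cos2 (ab : 0 < pi / 2 :> R) (S : set (R * R)) : measurable S ->
  (uniform_prob ab \x uniform_prob ab)%E [set z | S (sin z.1 ^+ 2, sin z.2 ^+ 2)] =
  (\int[U]_y U [set x | S (cos x ^+ 2, cos y ^+ 2)%R])%E.
Proof.
move=> mS.
have msin2 : measurable_fun setT (fun x : R => sin x ^+ 2).
  by apply: measurable_funX; exact: measurable_sin.
have mcos2 : measurable_fun setT (fun x : R => cos x ^+ 2).
  by apply: measurable_funX; exact: measurable_cos.
have mcomp (f g : R -> R) : measurable_fun setT f -> measurable_fun setT g ->
    measurable [set z : R * R | S (f z.1, g z.2)].
  move=> mf mg; rewrite -[X in measurable X]setTI.
  have mfg : measurable_fun setT (fun z : R * R => (f z.1, g z.2)).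
    by apply: measurable_fun_pair; exact: measurableT_comp.
  exact: mfg.
have S1 x : measurable [set y | S (x, y)].
  by rewrite -[X in measurable X]xsectionE; exact: measurable_xsection.
have S2 y : measurable [set x | S (x, y)].
  by rewrite -[X in measurable X]ysectionE; exact: measurable_ysection.
rewrite product_measure_sections /=.
transitivity (\int[uniform_prob ab]_x U [set y | S (sin x ^+ 2, cos y ^+ 2)%R])%E.
  by apply: eq_integral => x _; rewrite -(uniform_prob_sin2 ab (S1 (sin x ^+ 2))).
rewrite (@integral_probability_swap _ _ _ _ _ (uniform_prob ab) U _ (mcomp _ _ msin2
  mcos2)) /=.
by apply: eq_integral => y _; rewrite -(uniform_prob_sin2 ab (S2 (cos y ^+ 2))).
Qed.

End sine_law.

(** * Obtuse angles in the plane *)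
Section plane_geometry.
Context {R : realType}.
Implicit Types (u v : 'rV[R]_2) (p : 'I_3 -> 'rV[R]_2).

Lemma dotE u v : dot u v = u 0 0 * v 0 0 + u 0 1 * v 0 1.
Proof.
rewrite /dot mxE !big_ord_recl big_ord0 addr0 !mxE.
by congr (_ + u 0 _ * v 0 _); apply: val_inj.
Qed.

Lemma dotC u v : dot u v = dot v u.
Proof. by rewrite !dotE; congr (_ + _); exact: mulrC. Qed.

Lemma euclidean_norm_hypot u : euclidean_norm u = hypot (u 0 0) (u 0 1).
Proof. by rewrite /euclidean_norm dotE. Qed.

Lemma cauchy_schwarz u v : `|dot u v| <= euclidean_norm u * euclidean_norm v.
Proof.
rewrite !euclidean_norm_hypot ler_absl_sqr// mulr_ge0 ?hypot_ge0//=.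
rewrite real_normK ?num_real// exprMn !sqr_hypot dotE -subr_ge0.
rewrite (_ : _ - _ = (u 0 0 * v 0 1 - u 0 1 * v 0 0) ^+ 2) ?sqr_ge0//; ring.
Qed.

Lemma pihalf_lt_acos (x : R) : -1 <= x <= 1 -> (pi / 2 < acos x) = (x < 0).
Proof.
move=> x1; have := pi_gt0 R => pi0.
rewrite -ltr_cos ?in_itv/= ?acos_ge0 ?acos_lepi//; last by apply/andP; split; lra.
by rewrite cos_pihalf acosK// in_itv.
Qed.

(** If [A] coincides with [B] or [C], the quotient is [0] and the angle is
    [pi / 2], so no distinctness hypothesis is needed. *)
Lemma pihalf_lt_angle (B A C : 'rV[R]_2) :
  (pi / 2 < angle B A C) = (dot (B - A) (C - A) < 0).
Proof.
rewrite /angle; set d := dot _ _; set n := euclidean_norm _ * _.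
have dn : `|d| <= n by exact: cauchy_schwarz.
have [n0|n0] := eqVneq n 0.
  have -> : d = 0 by apply/eqP; rewrite -normr_le0 -n0.
  by rewrite mul0r acos0 !ltxx.
have np : 0 < n by rewrite lt_neqAle eq_sym n0 (le_trans _ dn).
rewrite pihalf_lt_acos; first by rewrite pmulr_llt0// invr_gt0.
by rewrite -ler_norml normrM normfV (gtr0_norm np) ler_pdivrMr// mul1r.
Qed.

(** The determinant of two plane vectors. *)
Definition cross u v : R := u 0 0 * v 0 1 - u 0 1 * v 0 0.

Lemma nondegenerate_cross p : Defs.nondegenerate p =
  (cross (p 1 - p 0) (p 2%:R - p 0) != 0).
Proof.
rewrite /Defs.nondegenerate; move: (p 1 - p 0) (p 2%:R - p 0) => u v.
pose M : 'M[R]_2 := col_mx u v.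
have -> : row_free (col_mx u v) = (M \in unitmx) by exact: row_free_unit.
rewrite unitmxE unitfE; congr (_ != 0).
have e i j : M i j = if i == 0 then u 0 j else v 0 j.
  rewrite /M mxE; case: splitP => k ik.
    by rewrite (ord1 k) (_ : i == 0) //; apply/eqP/val_inj; rewrite /= ik (ord1 k).
  by rewrite (ord1 k) (_ : i == 0 = false) //; apply/eqP => i0; rewrite i0 in ik.
clearbody M; rewrite (expand_det_row _ 0) !big_ord_recl big_ord0 /cofactor !det_mx11 !mxE.
rewrite !e /= /cross.
have -> : lift ord0 0 = 1 :> 'I_2 by apply: val_inj.
have -> : lift 1 0 = 0 :> 'I_2 by apply: val_inj.
by rewrite addr0 /bump /= expr0 expr1 mul1r mulN1r mulrN.
Qed.

Lemma interior_angle_dot p (i j k : 'I_3) : uniq [:: i; j; k] ->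
  (pi / 2 < interior_angle p k) = (dot (p i - p k) (p j - p k) < 0).
Proof.
move=> ijk; rewrite /interior_angle pihalf_lt_angle.
have [[-> ->]|[-> ->]] : i = k + 1 /\ j = k + 2%:R \/ i = k + 2%:R /\ j = k + 1.
- case: i j k ijk => [[|[|[|]]] hi]// [[|[|[|]]] hj]// [[|[|[|]]] hk]// _;
    by [left; split; apply: val_inj|right; split; apply: val_inj].
- by [].
- by rewrite dotC.
Qed.

(** Up to sign, twice the area does not depend on the order of the vertices. *)
Lemma cross_eq0_perm p (i j k : 'I_3) : uniq [:: i; j; k] ->
  (cross (p 1 - p 0) (p 2%:R - p 0) == 0) = (cross (p j - p i) (p k - p i) == 0).
Proof.
have E (u v w : 'rV[R]_2) : cross (v - u) (w - u) = cross u v + cross v w + cross w u.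
  by rewrite /cross !mxE; ring.
move=> ijk.
have [->|->] : cross (p j - p i) (p k - p i) = cross (p 1 - p 0) (p 2%:R - p 0) \/
     cross (p j - p i) (p k - p i) = - cross (p 1 - p 0) (p 2%:R - p 0).
- rewrite !E.
  have o0 (h : (0 < 3)%N) : p (Ordinal h) = p 0 by congr p; apply: val_inj.
  have o1 (h : (1 < 3)%N) : p (Ordinal h) = p 1 by congr p; apply: val_inj.
  have o2 (h : (2 < 3)%N) : p (Ordinal h) = p 2%:R by congr p; apply: val_inj.
  case: i j k ijk => [[|[|[|]]] hi]// [[|[|[|]]] hj]// [[|[|[|]]] hk]// _;
    rewrite ?o0 ?o1 ?o2; rewrite /cross; by [left; ring|right; ring].
- by [].
- by rewrite oppr_eq0.
Qed.

End plane_geometry.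

(** * The random triangle *)
Section random_triangle.
Context {R : realType} d (T : measurableType d) (P : probability T R).
Variables (r : 'I_3 -> R) (Theta : 'I_3 -> {RV P >-> R}).
Hypotheses (r_ge0 : forall k, 0 <= r k)
  (r_zero : forall i j, r i = 0 -> r j = 0 -> i = j)
  (Theta_unif : forall k, uniformly_distributed (Theta k) 0 (2 * pi))
  (Theta_indep : mutually_independent Theta).
Local Notation U := (@circle_prob R).

Let pts (w : T) (k : 'I_3) : 'rV[R]_2 := polar_point (r k) (Theta k w).

(** At most one radius vanishes. *)
Lemma add_radii_gt0 i j : i != j -> 0 < r i + r j.
Proof.
move=> ij; rewrite lt_neqAle addr_ge0// andbT eq_sym paddr_eq0//.
by apply/negP => /andP[/eqP ri /eqP rj]; move: ij; rewrite (r_zero ri rj) eqxx.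
Qed.

Lemma Theta_law k (A : set R) : measurable A -> P (Theta k @^-1` A) = U A.
Proof.
move=> mA; have [ab] := Theta_unif k => /(_ A mA).
by rewrite /distribution /pushforward => ->;
  rewrite /circle_prob (bool_irrelevance ab (@twopi_gt0 R)).
Qed.

Lemma Theta_triple_law (l m n : 'I_3) : uniq [:: l; m; n] ->
  forall S : set (R * (R * R)), measurable S ->
    P [set w | S (Theta l w, (Theta m w, Theta n w))] = (U \x (U \x U))%E S.
Proof.
rewrite /= !inE negb_or andbT => /andP[/andP[lm ln] mn] S mS.
apply: (triple_law (m1 := U) (m2 := U) (m3 := U)) => // A B C mA mB mC.
(* The family of events that equals [A], [B], [C] at the indices [l], [m], [n]. *)
pose D i := if i == l then A else if i == m then B else C.
have mD i : measurable (D i) by rewrite /D; case: ifP => // _; case: ifP.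
have Dl : D l = A by rewrite /D eqxx.
have Dm : D m = B by rewrite /D eq_sym (negbTE lm) eqxx.
have Dn : D n = C by rewrite /D eq_sym (negbTE ln) eq_sym (negbTE mn).
rewrite -(Theta_law l mA) -(Theta_law m mB) -(Theta_law n mC).
have := Theta_indep [set l; m; n]%SET mD.
rewrite (_ : \bigcap_(i in _) _ =
  Theta l @^-1` A `&` (Theta m @^-1` B `&` Theta n @^-1` C)).
  move=> ->; rewrite -Dl -Dm -Dn.
  rewrite -finset.setUA finset.big_setU1 ?finset.big_setU1 ?finset.big_set1 //= !inE
    ?negb_or ?lm//.
apply/seteqP; split => w /=.
  move=> h; rewrite -Dl -Dm -Dn.
  by split; [|split]; apply: h; rewrite /= !inE eqxx ?orbT.
move=> [h1 [h2 h3]] i /=; rewrite !inE -orbA => /or3P[] /eqP ->; rewrite ?Dl ?Dm ?Dn//.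
Qed.

Lemma Theta_measurable_event (l m n : 'I_3) (S : set (R * (R * R))) : measurable S ->
  measurable [set w | S (Theta l w, (Theta m w, Theta n w))].
Proof.
move=> mS; rewrite -[X in measurable X]setTI.
have mT : measurable_fun setT (fun w => (Theta l w, (Theta m w, Theta n w))).
  apply: measurable_fun_pair; first exact: (measurable_funPT (Theta l)).
  by apply: measurable_fun_pair;
    [exact: (measurable_funPT (Theta m))|exact: (measurable_funPT (Theta n))].
exact: mT.
Qed.

Let dotp (w : T) (k i j : 'I_3) := dot (pts w i - pts w k) (pts w j - pts w k).

Lemma dotpE w k i j :
  dotp w k i j = planar_dot (r i) (r j) (r k) (Theta i w) (Theta j w) (Theta k w).
Proof. by rewrite /dotp dotE !mxE. Qed.

Lemma crossE w k i j : cross (pts w i - pts w k) (pts w j - pts w k) =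
  planar_cross (r i) (r j) (r k) (Theta i w) (Theta j w) (Theta k w).
Proof. by rewrite /cross !mxE. Qed.

(** Non-degeneracy needs two vertices of positive radius; their names depend on
    which radius may vanish. *)
Lemma exists_positive_radii : exists l m n : 'I_3,
  [/\ uniq [:: l; m; n], 0 < r m & 0 < r n].
Proof.
have rp i j : i != j -> r i = 0 -> 0 < r j.
  by move=> ij ri; have := add_radii_gt0 ij; rewrite ri add0r.
have [r1|r1] := eqVneq (r 1) 0.
  by exists 1, 0, 2%:R; split => //; apply: (rp 1).
have [r2|r2] := eqVneq (r 2%:R) 0.
  by exists 2%:R, 0, 1; split => //; apply: (rp 2%:R).
by exists 0, 1, 2%:R; split => //; rewrite lt_neqAle eq_sym ?r1 ?r2 /=.
Qed.

Let degenerate : set T := [set w | ~~ Defs.nondegenerate (pts w)].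

Lemma degenerateE (l m n : 'I_3) : uniq [:: l; m; n] -> degenerate =
  [set w | planar_cross (r m) (r n) (r l) (Theta m w) (Theta n w) (Theta l w) = 0].
Proof.
move=> lmn; apply/seteqP; split => w;
  rewrite /degenerate /= nondegenerate_cross negbK (cross_eq0_perm _ lmn) crossE =>
    /eqP//.
Qed.

Lemma measurable_degenerate : measurable degenerate.
Proof.
rewrite (@degenerateE 0 1 2%:R) //.
exact: (Theta_measurable_event 0 1 2%:R (measurable_planar_cross (r 1) (r 2%:R) (r 0))).
Qed.

Lemma prob_degenerate : P degenerate = 0%E.
Proof.
have [l [m [n [lmn rm rn]]]] := exists_positive_radii.
rewrite (degenerateE lmn).
rewrite (Theta_triple_law lmn (measurable_planar_cross (r m) (r n) (r l))).
exact: circle_prob_planar_cross0.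
Qed.

Lemma obtuse_atE w (i j k : 'I_3) : uniq [:: i; j; k] ->
  obtuse_at (pts w) k <-> ~ degenerate w /\ dotp w k i j < 0.
Proof.
move=> ijk; rewrite /obtuse_at (interior_angle_dot _ ijk) /degenerate /=.
by split => -[h1 h2]; split => //; [apply/negP; rewrite negbK|apply/negPn/negP].
Qed.

Lemma measurable_dotp_lt0 k i j : measurable [set w | dotp w k i j < 0].
Proof.
rewrite (_ : [set _ | _] =
  [set w | planar_dot (r i) (r j) (r k) (Theta i w) (Theta j w) (Theta k w) < 0]).
  exact: (Theta_measurable_event k i j (measurable_planar_dot (r i) (r j) (r k))).
by apply/seteqP; split => w /=; rewrite dotpE.
Qed.

Lemma obtuse_at_setE (i j k : 'I_3) : uniq [:: i; j; k] ->
  [set w | obtuse_at (pts w) k] = [set w | dotp w k i j < 0] `\` degenerate.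
Proof. by move=> ijk; apply/seteqP; split => w /=; rewrite (obtuse_atE _ ijk) => -[]. Qed.

Lemma measurable_obtuse_at (i j k : 'I_3) : uniq [:: i; j; k] ->
  measurable [set w | obtuse_at (pts w) k].
Proof.
move=> ijk; rewrite (obtuse_at_setE ijk); apply: measurableD.
  exact: measurable_dotp_lt0.
exact: measurable_degenerate.
Qed.

Lemma prob_obtuse_at (i j k : 'I_3) : uniq [:: i; j; k] ->
  P [set w | obtuse_at (pts w) k] =
  ((2^-1)%:E * \int[U]_c
    U [set x | (r k ^+ 2 < r i ^+ 2 * cos x ^+ 2 + r j ^+ 2 * cos c ^+ 2)%R])%E.
Proof.
move=> ijk; have mD := measurable_dotp_lt0 k i j.
have mZ := measurable_degenerate.
have kij : uniq [:: k; i; j] by rewrite -(rot_uniq 1).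
have ik : i != k by move: ijk; rewrite /= !inE negb_or => /andP[/andP[]].
have jk : j != k by move: ijk; rewrite /= !inE andbT => /andP[_ ].
rewrite (obtuse_at_setE ijk).
transitivity (P [set w | dotp w k i j < 0]).
  rewrite [RHS](measureDI P mD mZ) [X in (_ = _ + X)%E](_ : _ = 0%E) ?adde0//.
  apply: (@subset_measure0 _ _ _ P _ degenerate) => //.
  - exact: measurableI.
  - exact: prob_degenerate.
rewrite -circle_prob_planar_dot_lt0//; [|exact: add_radii_gt0|exact: add_radii_gt0].
rewrite -(Theta_triple_law kij (measurable_planar_dot (r i) (r j) (r k))).
by congr (P _); apply/seteqP; split => w /=; rewrite dotpE.
Qed.

Lemma obtuse_at_disjoint w (k l : 'I_3) :
  obtuse_at (pts w) k -> obtuse_at (pts w) l -> k = l.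
Proof.
have [//|kl] := eqVneq k l.
have [m mkl] : exists m : 'I_3, uniq [:: l; m; k].
  (* Modulo [3] the three indices add up to [0]. *)
  exists (- (k + l)).
  by case: k l kl => [[|[|[|]]] hk]// [[|[|[|]]] hl].
have mlk : uniq [:: k; m; l].
  by rewrite -rev_uniq.
rewrite (obtuse_atE w mkl) (obtuse_atE w mlk) /dotp !dotE !mxE => -[_ h1] [_ h2].
exfalso.
(* The two dot products add up to the squared distance of the vertices [k] and [l]. *)
have := sqr_ge0 (pts w l 0 0 - pts w k 0 0); have := sqr_ge0 (pts w l 0 1 - pts w k 0 1).
rewrite !mxE /=; move: h1 h2 => /=; nra.
Qed.

Lemma prob_obtuse (i j : 'I_3 -> 'I_3) : (forall k, uniq [:: i k; j k; k]) ->
  P [set w | obtuse (pts w)] = (\sum_(k < 3) P [set w | obtuse_at (pts w) k])%E.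
Proof.
move=> ijk; rewrite -measure_bigsetU_ord.
- congr (P _); rewrite -bigcup_seq; apply/seteqP; split => w /=.
    by move=> [nd [k ka]]; exists k => //=; rewrite mem_index_enum.
  by move=> [k _ [nd ka]]; split => //; exists k.
- by move=> k; exact: (measurable_obtuse_at (ijk k)).
- by move=> k l _ _ [w [/= h1 h2]]; exact: (obtuse_at_disjoint h1 h2).
Qed.

End random_triangle.

Lemma prob_sin2_cos2 (R : realType) d (T : measurableType d) (Q : probability T R)
    (X Y : {RV Q >-> R}) (q p r : R) :
  uniformly_distributed X 0 (pi / 2) -> uniformly_distributed Y 0 (pi / 2) ->
  independent_pair X Y ->
  Q [set w | r ^+ 2 < q ^+ 2 * sin (X w) ^+ 2 + p ^+ 2 * sin (Y w) ^+ 2] =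
  (\int[@circle_prob R]_c (@circle_prob R)
    [set x | (r ^+ 2 < q ^+ 2 * cos x ^+ 2 + p ^+ 2 * cos c ^+ 2)%R])%E.
Proof.
move=> [ab EX] [ab' EY] XY.
pose S : set (R * R) := [set z | r ^+ 2 < q ^+ 2 * z.1 + p ^+ 2 * z.2].
have mS : measurable S.
  apply: measurable_set_lt => //; apply: measurable_funD; apply: measurable_funM => //.
rewrite -(integral_sin2_cos2 ab mS).
have mS' : measurable [set z : R * R | S (sin z.1 ^+ 2, sin z.2 ^+ 2)].
  apply: measurable_set_lt => //; apply: measurable_funD; apply: measurable_funM => //;
    apply: measurable_funX; apply: measurableT_comp => //; exact: measurable_sin.
rewrite -(pair_law (X := X) (Y := Y) (mu := uniform_prob ab) (nu := uniform_prob ab) _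
  _ XY mS')//.
Qed.

Theorem theorem4p1 (R : realType)
    (d : measure_display) (T : measurableType d) (P : probability T R)
    (d' : measure_display) (T' : measurableType d') (Q : probability T' R)
    (r : 'I_3 -> R)
    (r_ge0 : forall k, 0 <= r k)
    (r_zero : forall i j, r i = 0 -> r j = 0 -> i = j)
    (Theta : 'I_3 -> {RV P >-> R})
    (Theta_unif : forall k, uniformly_distributed (Theta k) 0 (2 * pi))
    (Theta_indep : mutually_independent Theta)
    (X Y : {RV Q >-> R})
    (X_unif : uniformly_distributed X 0 (pi / 2))
    (Y_unif : uniformly_distributed Y 0 (pi / 2))
    (XY_indep : independent_pair X Y) :
  let pts (w : T) (k : 'I_3) : 'rV[R]_2 := polar_point (r k) (Theta k w) in
  let prob (i j k : 'I_3) : \bar R :=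
    Q [set w | r k ^+ 2 < r i ^+ 2 * sin (X w) ^+ 2 + r j ^+ 2 * sin (Y w) ^+ 2] in
  (forall k i j : 'I_3, uniq [:: i; j; k] ->
     P [set w | obtuse_at (pts w) k] = ((2^-1)%:E * prob i j k)%E)
  /\
  (forall i j : 'I_3 -> 'I_3, (forall k, uniq [:: i k; j k; k]) ->
     P [set w | obtuse (pts w)]
       = ((2^-1)%:E * \sum_(k < 3) prob (i k) (j k) k)%E).
Proof.
move=> pts prob.
have probE k i j : uniq [:: i; j; k] ->
    P [set w | obtuse_at (pts w) k] = ((2^-1)%:E * prob i j k)%E.
  by move=> ijk; rewrite /prob prob_sin2_cos2//; exact: prob_obtuse_at.
split => // i j ijk.
rewrite (prob_obtuse _ _ ijk) ge0_sume_distrr//.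
by apply: eq_bigr => k _; exact: probE.
Qed.
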